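(* Let $d\ge2$, $1\le i\le d$, and let $P=H_i\cup B$ be an $i$-hyperplane $d$-SMP, where $H_i$ is the set of all tuples in $\{+,-\}^d$ whose $i$-th entry is $+$, and $B\neq\emptyset$ is a set of tuples in $\{+,-\}^d$ whose $i$-th entry is $-$. Let $B^{(i)}$ be the $(d-1)$-SMP obtained from $B$ by removing the $i$-th entry (which is a minus) in each $d$-tuple. Assume that there are $f(n,k)$ $(d-1)$-dimensional permutations of length $n$ with $k$ occurrences of $B^{(i)}$. Then, for $n\ge1$, there are $$\sum_{k=1}^{n}k\,(n-1)!\,f(n,k)$$ $d$-dimensional permutations of length $n$ with one occurrence of $P$, and the remaining $$(n!)^{d-1}-\sum_{k=1}^{n}k\,(n-1)!\,f(n,k)$$ $d$-dimensional permutations of length $n$ avoid $P$.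
   Context: A $d$-dimensional permutation $\Pi$ of length $n$ is an ordered $(d-1)$-tuple $(\pi^2,\dots,\pi^d)$ of permutations of $\{1,\dots,n\}$, with $\pi^i=\pi^i_1\cdots\pi^i_n$; set $\pi^1=12\cdots n$ (for $d=1$ there is a single permutation of each length $n$, consisting of $\pi^1$ only). Its elements are the $d$-tuples $\Pi_j=(\pi^1_j,\pi^2_j,\dots,\pi^d_j)^T$, $1\le j\le n$. A $d$-dimensional singleton mesh pattern ($d$-SMP) $P$ is a set of $d$-tuples in $\{+,-\}^d$. For $i\ne j$, $\mathrm{sign}(\Pi_j-\Pi_i)\in\{+,-\}^d$ denotes the tuple of componentwise signs. The element $\Pi_i$ is an occurrence of $P$ in $\Pi$ if there is no $j\neq i$ with $\mathrm{sign}(\Pi_j-\Pi_i)\in P$. $\Pi$ avoids $P$ if it has no occurrences of $P$. A $d$-SMP is an $i$-hyperplane $d$-SMP if it contains every tuple in $\{+,-\}^d$ whose $i$-th entry is $+$. *)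

(* Defs.v *)
From mathcomp Require Import all_boot all_order all_algebra all_fingroup.

Set Implicit Arguments.
Unset Strict Implicit.
Unset Printing Implicit Defensive.

(* Positions and values 1, ..., n are shifted to 'I_n, and the
   coordinates 1, ..., d to 'I_d. A sign is a boolean, true for + and false
   for -. *)

(* The tuple (pi^2, ..., pi^d); pi^1 is the identity and is not stored, so for
   d = 1 there is exactly one permutation of each length. *)
Definition dperm (d n : nat) := d.-1.-tuple 'S_n.

(* coord Pi a is pi^(a+1). The default of nth is never reached for a < d. *)
Definition coord (d n : nat) (Pi : dperm d n) (a : 'I_d) : 'S_n :=
  nth 1%g (1%g :: Pi) a.

Definition element (d n : nat) (Pi : dperm d n) (j : 'I_n) : d.-tuple 'I_n :=
  [tuple coord Pi a j | a < d].

(* Signs of the entries of v - u. Distinct elements of a permutation differ in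
   every coordinate, so the value chosen for a zero difference is irrelevant. *)
Definition sign_diff (d n : nat) (v u : d.-tuple 'I_n) : d.-tuple bool :=
  [tuple tnth u a < tnth v a | a < d].

Definition smp (d : nat) := {set d.-tuple bool}.

Definition occurrences (d n : nat) (P : smp d) (Pi : dperm d n) : {set 'I_n} :=
  [set x | [forall j, (j != x) ==>
             (sign_diff (element Pi j) (element Pi x) \notin P)]].

Definition avoids (d n : nat) (P : smp d) (Pi : dperm d n) : bool :=
  occurrences P Pi == set0.

Definition hyperplane (d : nat) (i : 'I_d) : smp d := [set s | tnth s i].

Definition is_hyperplane_smp (d : nat) (i : 'I_d) (P : smp d) : bool :=
  hyperplane i \subset P.

Definition remove_entry (d : nat) (i : 'I_d) (s : d.-tuple bool) :
    d.-1.-tuple bool :=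
  [tuple tnth s (lift i a) | a < d.-1].

Definition remove_coord (d : nat) (i : 'I_d) (B : smp d) : smp d.-1 :=
  [set remove_entry i s | s in B].

(* Main.v *)
Require Import Defs.
From mathcomp Require Import all_boot all_order all_algebra all_fingroup.

(** An element that is not the highest one in coordinate [i] has another element
    above it in that coordinate, hence is not an occurrence of [P]. So the only
    candidate is the element whose [i]-th coordinate is maximal, and since every
    other element lies below it in direction [i], it is an occurrence of [P] exactly
    when it becomes an occurrence of [remove_coord i B] once coordinate [i] is
    erased ([family_occurrences_insert]). In particular there is at most one
    occurrence, which makes the second and third claims consequences of the
    first.

    To count, take a [(d-1)]-dimensional permutation with [k] occurrences and
    insert a new coordinate [i]: its maximum has to sit at one of these [k]
    elements, and the other values can be placed in [(n-1)!] ways.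

    Erasing coordinate [i] is awkward for the normalised encoding, where the
    first coordinate is the identity: erasing the first coordinate would force a
    renumbering of the elements. The proof therefore counts unnormalised
    families of [d] permutations, that is, permutations together with a
    numbering of their elements. Renumbering does not affect the number of
    occurrences, so every count is multiplied by [n!] ([card_families]); this
    factor appears on both sides, for [d] and for [d - 1], and cancels. *)

Set Implicit Arguments.
Unset Strict Implicit.
Unset Printing Implicit Defensive.

Definition family_signs d n (g : {ffun 'I_d -> 'S_n}) (j x : 'I_n) :
    d.-tuple bool :=
  [tuple g a x < g a j | a < d].

Definition family_occurrences d n (P : smp d) (g : {ffun 'I_d -> 'S_n}) :
    {set 'I_n} :=
  [set x | [forall j, (j != x) ==> (family_signs g j x \notin P)]].

Definition renumber d n (s : 'S_n) (Pi : dperm d n) : {ffun 'I_d -> 'S_n} :=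
  [ffun a => (s * Defs.coord Pi a)%g].

(** Being an occurrence depends only on the set of elements, so the numbering
    [s] merely transports the occurrences. *)
Lemma card_occurrences_renumber d n (P : smp d) (s : 'S_n) (Pi : dperm d n) :
  #|family_occurrences P (renumber s Pi)| = #|occurrences P Pi|.
Proof.
suff -> : family_occurrences P (renumber s Pi) = s @^-1: occurrences P Pi.
  by rewrite card_preimset //; apply: perm_inj.
have signsE j x :
    family_signs (renumber s Pi) j x
    = sign_diff (element Pi (s j)) (element Pi (s x)).
  by apply: eq_from_tnth => a; rewrite !tnth_mktuple !ffunE !permM.
apply/setP=> x; rewrite !inE; apply/forallP/forallP => occ j.
  have := occ ((s^-1)%g j).
  by rewrite signsE permKV (can2_eq (permKV s) (permK s)).
by have := occ (s j); rewrite (inj_eq perm_inj) signsE.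
Qed.

Lemma renumber_bij d n :
  bijective (fun sPi : 'S_n * dperm d.+1 n => renumber sPi.1 sPi.2).
Proof.
apply: inj_card_bij => [[s Pi] [t Sigma] /= /ffunP eq_st|]; last first.
  by rewrite card_ffun card_prod card_tuple card_ord expnS.
(* The first coordinate of a permutation is the identity, so the first
   coordinate of the family is the renumbering itself. *)
have st : s = t by have := eq_st ord0; rewrite !ffunE /Defs.coord /= !mulg1.
rewrite -{t}st in eq_st *; congr (_, _); apply: eq_from_tnth => a.
have := eq_st (lift ord0 a); rewrite !ffunE => /mulgI.
by rewrite /Defs.coord /= !(tnth_nth 1%g).
Qed.

(** Reading the first coordinate of a family as the numbering and correcting the
    other coordinates by it shows that a family is a permutation together with
    one of [n!] numberings. *)
Lemma card_families d n (P : smp d.+1) k :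
  #|[set g : {ffun 'I_d.+1 -> 'S_n} | #|family_occurrences P g| == k]|
  = n`! * #|[set Pi : dperm d.+1 n | #|occurrences P Pi| == k]|.
Proof.
rewrite -(card_Sn n) -[#|'S_n|]cardsT -cardsX.
rewrite -(on_card_preimset (onW_bij _ (renumber_bij d n))).
by apply: eq_card => -[s Pi]; rewrite !inE card_occurrences_renumber.
Qed.

Definition insert_coord d n (i : 'I_d.+1) (sh : 'S_n * {ffun 'I_d -> 'S_n}) :
    {ffun 'I_d.+1 -> 'S_n} :=
  [ffun a => oapp sh.2 sh.1 (unlift i a)].

Lemma insert_coord_bij d n (i : 'I_d.+1) : bijective (@insert_coord d n i).
Proof.
apply: inj_card_bij => [[s h] [t l] /ffunP eq_st|]; last first.
  by rewrite card_prod !card_ffun !card_ord expnS.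
congr (_, _); first by have := eq_st i; rewrite !ffunE unlift_none.
by apply/ffunP=> a; have := eq_st (lift i a); rewrite !ffunE liftK.
Qed.

(** Erasing entry [i] loses no information here, because that entry is a minus
    both in [s] and in all tuples of [B]. *)
Lemma mem_remove_coord d (i : 'I_d.+1) (B : smp d.+1) (s : d.+1.-tuple bool) :
  (forall t : d.+1.-tuple bool, t \in B -> tnth t i = false) ->
  tnth s i = false -> (remove_entry i s \in remove_coord i B) = (s \in B).
Proof.
move=> B_minus s_minus; apply/imsetP/idP => [[t tB eq_st]|sB]; last by exists s.
suff -> : s = t by [].
apply: eq_from_tnth => a; case: (unliftP i a) => [b ->|->].
  by have := congr1 (fun u => tnth u b) eq_st; rewrite !tnth_mktuple.
by rewrite s_minus B_minus.
Qed.

(** Above the element with maximal coordinate [i] there is nothing in direction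
    [i], so the half-space imposes no condition on it and only the tuples of
    [B], with their minus at [i] erased, remain to be tested. *)
Lemma family_occurrences_insert d n (i : 'I_d.+1) (B : smp d.+1) (s : 'S_n.+1)
    (h : {ffun 'I_d -> 'S_n.+1}) (x : 'I_n.+1) :
  (forall t : d.+1.-tuple bool, t \in B -> tnth t i = false) ->
  (x \in family_occurrences (hyperplane i :|: B) (insert_coord i (s, h)))
  = (s x == ord_max) && (x \in family_occurrences (remove_coord i B) h).
Proof.
move=> B_minus; set g := insert_coord i (s, h).
have sign_i j : tnth (family_signs g j x) i = (s x < s j).
  by rewrite tnth_mktuple ffunE unlift_none.
have remove_i j : remove_entry i (family_signs g j x) = family_signs h j x.
  by apply: eq_from_tnth => a; rewrite !tnth_mktuple ffunE liftK.
have [sx_max|sx_neq_max] := eqVneq (s x) ord_max => /=.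
  rewrite !inE; apply: eq_forallb => j; congr (_ ==> ~~ _).
  have minus : tnth (family_signs g j x) i = false.
    by rewrite sign_i sx_max ltnNge -ltnS ltn_ord.
  by rewrite !inE minus -remove_i mem_remove_coord.
apply/negbTE; rewrite inE negb_forall; apply/existsP.
(* The element that is highest in coordinate i lies in the half-space H_i
   seen from x. *)
exists ((s^-1)%g ord_max); rewrite negb_imply negbK !inE sign_i permKV.
rewrite (can2_eq (permKV s) (permK s)) eq_sym sx_neq_max /=.
by rewrite ltn_neqAle -ltnS ltn_ord andbT sx_neq_max.
Qed.

(** Of two elements, the lower one in coordinate [i] is excluded by the other. *)
Lemma card_occurrences_le1 d n (i : 'I_d) (B : smp d) (Pi : dperm d n) :
  #|occurrences (hyperplane i :|: B) Pi| <= 1.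
Proof.
apply/card_le1_eqP => x y; rewrite !inE => /forallP x_occ /forallP y_occ.
apply/eqP; apply: contraT => y_neq_x.
have := x_occ y; have := y_occ x; rewrite [x == y]eq_sym y_neq_x /= !inE.
rewrite !tnth_mktuple !negb_or -!leqNgt => /andP[le_xy _] /andP[le_yx _].
have : Defs.coord Pi i x = Defs.coord Pi i y.
  by apply/val_inj/eqP; rewrite eqn_leq le_xy le_yx.
by move/perm_inj => eq_xy; rewrite eq_xy eqxx in y_neq_x.
Qed.

Lemma card_perm_to n (x y : 'I_n.+1) : #|[set s : 'S_n.+1 | s x == y]| = n`!.
Proof.
have card_others : #|[set~ x]| = n by rewrite cardsC1 card_ord.
rewrite -[in RHS]card_others -card_perm -[RHS](card_imset _ (mulIg (tperm x y))).
apply: eq_card => s; rewrite inE; apply/eqP/imsetP => [sx|[t t_on ->]].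
  exists (s * tperm x y)%g; last by rewrite -mulgA tperm2 mulg1.
  apply/subsetP=> z; rewrite !inE; apply: contraNneq => ->.
  by rewrite permM sx tpermR.
by rewrite permM (out_perm t_on) ?tpermL // !inE eqxx.
Qed.

Lemma card_perm_max_in n (S : {set 'I_n.+1}) :
  #|[set s : 'S_n.+1 | (s^-1)%g ord_max \in S]| = #|S| * n`!.
Proof.
rewrite -sum1dep_card (partition_big (fun s : 'S_n.+1 => (s^-1)%g ord_max)
  (mem S)) //= -sum_nat_const.
apply: eq_bigr => x xS; rewrite -(card_perm_to x ord_max) sum1dep_card.
apply: eq_card => s; rewrite !inE (can2_eq (permKV s) (permK s)).
by rewrite [ord_max == _]eq_sym andb_idl // => /eqP <-; rewrite permK.
Qed.

(** For a fixed remaining family [h], a single occurrence arises exactly when the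
    inserted coordinate has its maximum at one of the occurrences of [h]. *)
Lemma card_families_hyperplane d n (i : 'I_d.+1) (B : smp d.+1) :
  (forall t : d.+1.-tuple bool, t \in B -> tnth t i = false) ->
  #|[set g : {ffun 'I_d.+1 -> 'S_n.+1} |
      #|family_occurrences (hyperplane i :|: B) g| == 1]|
  = \sum_(h : {ffun 'I_d -> 'S_n.+1})
      #|family_occurrences (remove_coord i B) h| * n`!.
Proof.
move=> B_minus; rewrite -(on_card_preimset (onW_bij _ (insert_coord_bij n.+1 i))).
rewrite -sum1dep_card.
under [RHS]eq_bigr do rewrite -card_perm_max_in -sum1dep_card.
rewrite pair_big_dep /= [RHS](reindex (fun sh => (sh.2, sh.1))) /=; last first.
  by exists (fun hs => (hs.2, hs.1)) => -[].
apply: eq_bigl => -[s h] /=; rewrite 2![LHS]inE /=.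
set top := (s^-1)%g ord_max.
have -> : family_occurrences (hyperplane i :|: B) (insert_coord i (s, h))
    = [set top] :&: family_occurrences (remove_coord i B) h.
  apply/setP => x.
  by rewrite family_occurrences_insert // (can2_eq (permK s) (permKV s)) !inE.
case: (boolP (top \in _)) => [top_occ|top_not_occ].
  by rewrite (setIidPl _) ?cards1 // sub1set.
by rewrite (disjoint_setI0 _) ?cards0 // disjoints1.
Qed.

(** The sum may start at 1 because the value 0 contributes nothing. *)
Lemma sum_by_value (T : finType) (w : T -> nat) n c :
  (forall x, w x <= n) ->
  \sum_x w x * c = \sum_(1 <= k < n.+1) k * c * #|[set x | w x == k]|.
Proof.
move=> w_le; have w_ord x : w x < n.+1 by rewrite ltnS.
rewrite (partition_big (fun x => Ordinal (w_ord x)) xpredT) //=.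
transitivity (\sum_(k < n.+1) k * c * #|[set x | w x == k]|).
  apply: eq_bigr => k _; rewrite mulnC -sum_nat_const.
  by apply: eq_big => [x|x /eqP <- //]; rewrite inE.
rewrite -(big_mkord xpredT (fun k => k * c * #|[set x | w x == k]|)).
by rewrite big_ltn // !mul0n.
Qed.

Theorem theorem15 (d : nat) (hd : 2 <= d) (i : 'I_d) (P B : smp d)
    (hP : is_hyperplane_smp i P)
    (hPB : P = hyperplane i :|: B)
    (hB0 : B != set0)
    (hB : forall s : d.-tuple bool, s \in B -> tnth s i = false)
    (f : nat -> nat -> nat)
    (hf : forall n k : nat,
        #|[set Q : dperm d.-1 n | #|occurrences (remove_coord i B) Q| == k]|
        = f n k)
    (n : nat) (hn : 1 <= n) :
  [/\ #|[set Pi : dperm d n | #|occurrences P Pi| == 1]|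
      = \sum_(1 <= k < n.+1) k * (n.-1)`! * f n k,
      [set Pi : dperm d n | avoids P Pi]
      = ~: [set Pi : dperm d n | #|occurrences P Pi| == 1]
    & (#|[set Pi : dperm d n | avoids P Pi]|%:Z
       = (n`! ^ d.-1)%N%:Z
         - (\sum_(1 <= k < n.+1) k * (n.-1)`! * f n k)%N%:Z)%R].
Proof.
have one_occ : #|[set Pi : dperm d n | #|occurrences P Pi| == 1]|
    = \sum_(1 <= k < n.+1) k * (n.-1)`! * f n k.
  case: d hd i P B hPB hB hf {hP hB0} => [|[|d]] // _ i P B -> hB hf.
  case: n hn => // n _; apply/eqP.
  (* Pass to families in dimension d on the left, and back from families in
     dimension d - 1 on the right. *)
  rewrite -(eqn_pmul2l (fact_gt0 n.+1)) -card_families.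
  rewrite card_families_hyperplane // (@sum_by_value _ _ n.+1); last first.
    by move=> h; rewrite -[leqRHS]card_ord max_card.
  rewrite big_distrr /=; apply/eqP/eq_bigr => k _.
  by rewrite card_families hf mulnCA.
have avoidsE : [set Pi : dperm d n | avoids P Pi]
    = ~: [set Pi : dperm d n | #|occurrences P Pi| == 1].
  apply/setP => Pi; rewrite !inE /avoids -cards_eq0 hPB.
  by have := card_occurrences_le1 i B Pi; case: #|_| => [|[]].
split=> //; rewrite -one_occ avoidsE.
have <- : #|{: dperm d n}| = n`! ^ d.-1 by rewrite card_tuple card_Sn.
rewrite -(cardsC [set Pi : dperm d n | #|occurrences P Pi| == 1]).
by rewrite PoszD GRing.addrAC GRing.subrr GRing.add0r.
Qed.
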